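(* Assume that there are no $\omega$-measurable cardinals. Let $\mathcal{A}$ be a locally finitely presented additive category and let $M\in\mathcal{A}$ be such that $\mathrm{Prod}(M)$ is a precovering class (in particular, this applies if $\mathrm{Prod}(M)$ is a covering class). Then $\mathrm{Prod}(M)$ is closed under direct limits (i.e. colimits in $\mathcal{A}$ of directed systems of objects of $\mathrm{Prod}(M)$ belong to $\mathrm{Prod}(M)$).
   Context: An object $X$ of an additive category with filtered colimits is finitely presented if $\mathrm{Hom}(X,-)$ commutes with filtered colimits. A locally finitely presented category is a cocomplete additive category $\mathcal{A}$ whose finitely presented objects form an essentially small full subcategory $\mathrm{fp}\,\mathcal{A}$ and in which every object is a filtered colimit of finitely presented objects; such a category is idempotent complete and has cokernels, filtered colimits, direct sums and direct products. For an object $M$, $\mathrm{Prod}(M)$ is the class of all direct summands of direct products of copies of $M$. Let $\mathcal{C}$ be a class of objects of $\mathcal{A}$. A $\mathcal{C}$-precover of an object $A$ is a morphism $f:C\to A$ with $C\in\mathcal{C}$ such that every morphism $g:C'\to A$ with $C'\in\mathcal{C}$ can be written $g=fh$ for some $h:C'\to C$. A $\mathcal{C}$-precover $f:C\to A$ is a $\mathcal{C}$-cover if every $h:C\to C$ with $f=fh$ is an automorphism. The class $\mathcal{C}$ is precovering (resp. covering) if every object of $\mathcal{A}$ has a $\mathcal{C}$-precover (resp. $\mathcal{C}$-cover). A cardinal $\kappa=|I|$ is $\omega$-measurable if it is uncountable and there is a countably additive $\{0,1\}$-valued measure $\mu$ defined on all subsets of $I$ with $\mu(I)=1$ and $\mu(\{x\})=0$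 for all $x\in I$. *)

(* Defs.v *)
From mathcomp Require Import all_boot all_algebra.
From mathcomp Require Import boolp classical_sets cardinality filter topology.

Set Implicit Arguments.
Unset Strict Implicit.
Unset Printing Implicit Defensive.

(* The universe of sets. Hom-sets, index categories of (co)limits and the
   cardinals in [omega_measurable] all live at this level; the objects of a
   category may live in a strictly larger universe. *)
Definition Small := Type.

Section OmegaMeasurable.
Local Open Scope classical_set_scope.

(* [nat] carries the discrete topology. *)
Definition countably_additive (I : Type) (mu : set I -> nat) : Prop :=
  forall F : nat -> set I, trivIset [set: nat] F ->
    (fun n => \sum_(0 <= i < n) mu (F i))%N @ \oo --> mu (\bigcup_n F n).

Definition omega_measurable (I : Small) : Prop :=
  ~ countable [set: I] /\
  exists mu : set I -> nat,
    [/\ forall A, mu A = 0%N \/ mu A = 1%N,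
        countably_additive mu,
        mu [set: I] = 1%N
      & forall x, mu [set x] = 0%N].

End OmegaMeasurable.

Record category (Ob : Type) := Category {
  Hom : Ob -> Ob -> Small;
  idm : forall X, Hom X X;
  comp : forall X Y Z, Hom Y Z -> Hom X Y -> Hom X Z;
  comp1m : forall X Y (f : Hom X Y), comp (idm Y) f = f;
  compm1 : forall X Y (f : Hom X Y), comp f (idm X) = f;
  compmA : forall W X Y Z (h : Hom Y Z) (g : Hom X Y) (f : Hom W X),
    comp h (comp g f) = comp (comp h g) f
}.

Arguments Hom {Ob} c X Y.
Arguments idm {Ob c} X.
Arguments comp {Ob c X Y Z} g f.

Declare Scope cat_scope.
Delimit Scope cat_scope with cat.
Notation "g \oc f" := (comp g f) (at level 40, left associativity) : cat_scope.
Local Open Scope cat_scope.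

Record functor (J Ob : Type) (cJ : category J) (C : category Ob) := Functor {
  fobj :> J -> Ob;
  fmap : forall i j, Hom cJ i j -> Hom C (fobj i) (fobj j);
  fmap1 : forall i, fmap (idm i) = idm (fobj i);
  fmapM : forall i j k (v : Hom cJ j k) (u : Hom cJ i j),
    fmap (v \oc u) = fmap v \oc fmap u
}.

Arguments fmap {J Ob cJ C} f {i j} u.

Section FunctorComposition.
Variables (J Ob Ob' : Type).
Variables (cJ : category J) (C : category Ob) (C' : category Ob').
Variables (F : functor C C') (D : functor cJ C).

Lemma fcomp_fmap1 i : fmap F (fmap D (idm i)) = idm (F (D i)).
Proof. by rewrite !fmap1. Qed.

Lemma fcomp_fmapM i j k (v : Hom cJ j k) (u : Hom cJ i j) :
  fmap F (fmap D (v \oc u)) = fmap F (fmap D v) \oc fmap F (fmap D u).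
Proof. by rewrite !fmapM. Qed.

Definition fcomp : functor cJ C' :=
  @Functor J Ob' cJ C' (fun i => F (D i))
    (fun i j u => fmap F (fmap D u)) fcomp_fmap1 fcomp_fmapM.
End FunctorComposition.

Definition set_category : category Small :=
  @Category Small (fun S T => S -> T) (fun S x => x)
    (fun S T U g f x => g (f x))
    (fun _ _ _ => erefl) (fun _ _ _ => erefl) (fun _ _ _ _ _ _ _ => erefl).

Section HomFunctor.
Variables (Ob : Type) (C : category Ob) (X : Ob).

Lemma hom_fmap1 (Y : Ob) : (fun f : Hom C X Y => idm Y \oc f) = id.
Proof. by apply: funext => f; rewrite comp1m. Qed.

Lemma hom_fmapM (Y Z T : Ob) (v : Hom C Z T) (u : Hom C Y Z) :
  (fun f : Hom C X Y => (v \oc u) \oc f) = (fun f => v \oc (u \oc f)).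
Proof. by apply: funext => f; rewrite compmA. Qed.

Definition hom_functor : functor C set_category :=
  @Functor Ob Small C set_category (Hom C X) (fun Y Z u f => u \oc f)
    hom_fmap1 hom_fmapM.
End HomFunctor.

Section CategoryTheory.
Variables (Ob : Type) (C : category Ob).

Definition is_iso (X Y : Ob) (f : Hom C X Y) : Prop :=
  exists g : Hom C Y X, g \oc f = idm X /\ f \oc g = idm Y.

Definition isomorphic (X Y : Ob) : Prop :=
  exists f : Hom C X Y, is_iso f.

Definition is_cocone (J : Type) (cJ : category J) (D : functor cJ C)
    (X : Ob) (c : forall i, Hom C (D i) X) : Prop :=
  forall i j (u : Hom cJ i j), c j \oc fmap D u = c i.

Definition is_colimit (J : Type) (cJ : category J) (D : functor cJ C)
    (X : Ob) (c : forall i, Hom C (D i) X) : Prop :=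
  is_cocone c /\
  forall (Y : Ob) (d : forall i, Hom C (D i) Y), is_cocone d ->
    exists! h : Hom C X Y, forall i, h \oc c i = d i.

Definition is_product (I : Type) (X : I -> Ob)
    (P : Ob) (p : forall i, Hom C P (X i)) : Prop :=
  forall (Y : Ob) (f : forall i, Hom C Y (X i)),
    exists! h : Hom C Y P, forall i, p i \oc h = f i.

Definition cocomplete : Prop :=
  forall (J : Small) (cJ : category J) (D : functor cJ C),
    exists (X : Ob) (c : forall i, Hom C (D i) X), is_colimit c.

Definition initial (Z : Ob) : Prop := forall X, exists! f : Hom C Z X, True.

Definition terminal (Z : Ob) : Prop := forall X, exists! f : Hom C X Z, True.

(* The full subcategory on the objects satisfying P is essentially small;
   hom-sets being small, only the isomorphism classes matter. *)
Definition essentially_small (P : Ob -> Prop) : Prop :=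
  exists (S : Small) (G : S -> Ob),
    (forall s, P (G s)) /\ (forall X, P X -> exists s, isomorphic X (G s)).

End CategoryTheory.

Record filtered (J : Type) (cJ : category J) : Prop := Filtered {
  filtered_nonempty : exists i : J, True;
  filtered_ub : forall i j : J,
    exists k, (exists u : Hom cJ i k, True) /\ (exists v : Hom cJ j k, True);
  filtered_coeq : forall (i j : J) (u v : Hom cJ i j),
    exists k (w : Hom cJ j k), w \oc u = w \oc v
}.

Definition preserves_filtered_colimits (Ob Ob' : Type)
    (C : category Ob) (C' : category Ob') (F : functor C C') : Prop :=
  forall (J : Small) (cJ : category J) (D : functor cJ C)
    (X : Ob) (c : forall i, Hom C (D i) X),
    filtered cJ -> is_colimit c ->
    is_colimit (D := fcomp F D) (fun i => fmap F (c i)).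

(* Filtered colimits of abelian groups are created in sets, so the set-valued
   hom-functor may be used. *)
Definition finitely_presented (Ob : Type) (C : category Ob) (X : Ob) : Prop :=
  preserves_filtered_colimits (hom_functor C X).

(* Antisymmetry is not required. *)
Record directed_set (J : Type) (le : J -> J -> Prop) : Prop := DirectedSet {
  dir_nonempty : exists i : J, True;
  dir_refl : forall i, le i i;
  dir_trans : forall i j k, le i j -> le j k -> le i k;
  dir_ub : forall i j, exists k, le i k /\ le j k
}.

Definition directed_category (J : Type) (le : J -> J -> Prop)
    (dJ : directed_set le) : category J :=
  @Category J le (dir_refl dJ) (fun i j k v u => dir_trans dJ u v)
    (fun _ _ _ => Prop_irrelevance _ _) (fun _ _ _ => Prop_irrelevance _ _)
    (fun _ _ _ _ _ _ _ => Prop_irrelevance _ _).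

Definition closed_under_direct_limits (Ob : Type) (C : category Ob)
    (P : Ob -> Prop) : Prop :=
  forall (J : Small) (le : J -> J -> Prop) (dJ : directed_set le)
    (D : functor (directed_category dJ) C)
    (X : Ob) (c : forall i, Hom C (D i) X),
    (forall i, P (D i)) -> is_colimit c -> P X.

(* The abelian group structures are given as structures on the hom-sets, rather
   than by hom-objects in [zmodType], so that hom-sets stay in [Small]. *)
Definition hom_zmod (Ob : Type) (C : category Ob)
    (Z : forall X Y, GRing.Zmodule (Hom C X Y)) (X Y : Ob) : zmodType :=
  GRing.Zmodule.Pack (Z X Y).

Record preadditive (Ob : Type) := Preadditive {
  pa_cat :> category Ob;
  pa_zmod : forall X Y, GRing.Zmodule (Hom pa_cat X Y);
  compDl : forall X Y Z (g1 g2 : hom_zmod pa_zmod Y Z) (f : Hom pa_cat X Y),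
    (g1 + g2)%R \oc f =
      ((g1 \oc f : hom_zmod pa_zmod X Z) + (g2 \oc f : hom_zmod pa_zmod X Z))%R;
  compDr : forall X Y Z (g : Hom pa_cat Y Z) (f1 f2 : hom_zmod pa_zmod X Y),
    g \oc (f1 + f2)%R =
      ((g \oc f1 : hom_zmod pa_zmod X Z) + (g \oc f2 : hom_zmod pa_zmod X Z))%R
}.

Definition HomZ (Ob : Type) (A : preadditive Ob) (X Y : Ob) : zmodType :=
  hom_zmod (@pa_zmod Ob A) X Y.

Section AdditiveCategories.
Variables (Ob : Type) (A : preadditive Ob).

Definition is_biproduct (X Y P : Ob) (i1 : Hom A X P) (i2 : Hom A Y P)
    (p1 : Hom A P X) (p2 : Hom A P Y) : Prop :=
  [/\ p1 \oc i1 = idm X, p2 \oc i2 = idm Y,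
      p1 \oc i2 = (0%R : HomZ A Y X), p2 \oc i1 = (0%R : HomZ A X Y)
    & ((i1 \oc p1 : HomZ A P P) + (i2 \oc p2 : HomZ A P P))%R = idm P].

Definition additive : Prop :=
  (exists Z : Ob, initial A Z /\ terminal A Z) /\
  (forall X Y : Ob, exists (P : Ob) (i1 : Hom A X P) (i2 : Hom A Y P)
     (p1 : Hom A P X) (p2 : Hom A P Y), is_biproduct i1 i2 p1 p2).

Definition locally_finitely_presented : Prop :=
  [/\ additive, cocomplete A,
      essentially_small A (finitely_presented A)
    & forall X : Ob, exists (J : Small) (cJ : category J) (D : functor cJ A)
        (c : forall i, Hom A (D i) X),
        [/\ filtered cJ, forall i, finitely_presented A (D i) & is_colimit c]].

Definition direct_summand (X P : Ob) : Prop :=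
  exists (Y : Ob) (i1 : Hom A X P) (i2 : Hom A Y P)
    (p1 : Hom A P X) (p2 : Hom A P Y), is_biproduct i1 i2 p1 p2.

Definition Prod (M X : Ob) : Prop :=
  exists (I : Small) (P : Ob) (p : forall i : I, Hom A P M),
    is_product (X := fun=> M) p /\ direct_summand X P.

End AdditiveCategories.

Section Approximations.
Variables (Ob : Type) (C : category Ob) (P : Ob -> Prop).

Definition precover (X Y : Ob) (f : Hom C X Y) : Prop :=
  P X /\ forall (X' : Ob) (g : Hom C X' Y), P X' ->
    exists h : Hom C X' X, g = f \oc h.

Definition cover (X Y : Ob) (f : Hom C X Y) : Prop :=
  precover f /\ forall h : Hom C X X, f = f \oc h -> is_iso h.

Definition precovering : Prop :=
  forall Y : Ob, exists (X : Ob) (f : Hom C X Y), precover f.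

Definition covering : Prop :=
  forall Y : Ob, exists (X : Ob) (f : Hom C X Y), cover f.

End Approximations.

(* Main.v *)
(**
  Prod(M) precovering forces M to satisfy the descending chain condition on
  pp-definable subgroups of Hom(G, M), for G finitely presented.  Indeed let
  f : M^I -> M^(J) be (up to a summand) a precover with J very large.  As the
  canonical injections M -> M^(J) factor through f, every pp-functor U maps
  onto U(M)^(J) under f.  On the other hand, for a descending sequence U_n and
  in the absence of measurable cardinals, Chase's lemma gives n and a finite
  F in I such that f maps U_n(M^(I - F)) into a finite subsum, modulo the
  intersection of the U_k.  If the sequence does not stabilise, then J embeds,
  up to finitely many points, into the small set Hom(G, M)^F.

  Now let X be a direct limit of objects of Prod(M) and f : M^I -> X (up to a
  summand) a precover; it is a pure epimorphism.  The chain condition makes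
  the intersections of ker f with pp-definable subgroups satisfy the
  descending chain condition too, hence ker f is algebraically compact and f
  splits: a maximal finitely extendable partial section is total.
*)
From HB Require Import structures.
From mathcomp Require Import all_boot ssralg.
From mathcomp Require Import boolp classical_sets functions cardinality.
From mathcomp Require Import filter topology.
Require Import Defs.

Set Implicit Arguments.
Unset Strict Implicit.
Unset Printing Implicit Defensive.

Import GRing.Theory.
Local Open Scope ring_scope.
Local Open Scope cat_scope.

(** Lets the group operations be written on [Hom A X Y] itself rather than on [HomZ A X Y]. *)
HB.instance Definition _ (Ob : Type) (A : preadditive Ob) (X Y : Ob) :=
  GRing.Zmodule.copy (Hom A X Y) (HomZ A X Y).

(** * Bilinearity of composition *)

Section Bilinearity.
Variables (Ob : Type) (A : preadditive Ob) (X Y Z : Ob).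
Implicit Types (f : Hom A X Y) (g : Hom A Y Z).

Lemma comp_addl g1 g2 f : (g1 + g2) \oc f = g1 \oc f + g2 \oc f.
Proof. exact: compDl. Qed.

Lemma comp_addr g f1 f2 : g \oc (f1 + f2) = g \oc f1 + g \oc f2.
Proof. exact: compDr. Qed.

Lemma comp_0l f : (0 : Hom A Y Z) \oc f = 0.
Proof. by apply: (addrI ((0 : Hom A Y Z) \oc f)); rewrite -comp_addl !addr0. Qed.

Lemma comp_0r g : g \oc (0 : Hom A X Y) = 0.
Proof. by apply: (addrI (g \oc (0 : Hom A X Y))); rewrite -comp_addr !addr0. Qed.

Lemma comp_oppl g f : (- g) \oc f = - (g \oc f).
Proof. by apply: (addrI (g \oc f)); rewrite -comp_addl !subrr comp_0l. Qed.

Lemma comp_oppr g f : g \oc (- f) = - (g \oc f).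
Proof. by apply: (addrI (g \oc f)); rewrite -comp_addr !subrr comp_0r. Qed.

Lemma comp_subl g1 g2 f : (g1 - g2) \oc f = g1 \oc f - g2 \oc f.
Proof. by rewrite comp_addl comp_oppl. Qed.

Lemma comp_subr g f1 f2 : g \oc (f1 - f2) = g \oc f1 - g \oc f2.
Proof. by rewrite comp_addr comp_oppr. Qed.

Lemma comp_suml (I : Type) (r : seq I) (P : pred I) (F : I -> Hom A Y Z) f :
  (\sum_(i <- r | P i) F i) \oc f = \sum_(i <- r | P i) (F i \oc f).
Proof.
exact: (big_morph (fun g => g \oc f) (fun g1 g2 => comp_addl g1 g2 f) (comp_0l f)).
Qed.

Lemma comp_sumr (I : Type) (r : seq I) (P : pred I) (F : I -> Hom A X Y) g :
  g \oc (\sum_(i <- r | P i) F i) = \sum_(i <- r | P i) (g \oc F i).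
Proof.
exact: (big_morph (fun f => g \oc f) (comp_addr g) (comp_0r g)).
Qed.
End Bilinearity.

(** * Finitely presented objects and density *)

Section FinitelyPresented.
Variables (Ob : Type) (C : category Ob) (G : Ob).
Hypothesis fpG : finitely_presented C G.
Variables (J : Small) (cJ : category J) (D : functor cJ C).
Variables (X : Ob) (c : forall i, Hom C (D i) X).
Hypotheses (fJ : filtered cJ) (cX : is_colimit c).

(* Test against maps into the set [Prop]. *)
Lemma fp_factor (g : Hom C G X) : exists i (h : Hom C G (D i)), g = c i \oc h.
Proof.
have [_ /(_ Prop (fun _ _ => True))] := fpG fJ cX.
case=> [//|h [_ hU]].
(* Both the constant [True] and membership in the union of the images extend the constant cocone, so
   they agree. *)
have T1 : h = (fun=> True) by apply: hU.
have T2 : h = (fun x => exists i (y : Hom C G (D i)), x = c i \oc y).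
  apply: hU => i; apply: funext => y; rewrite propeqE; split=> // _.
  by exists i, y.
have hg : h g by rewrite T1.
by rewrite T2 in hg.
Qed.

Lemma fp_eq i (g h : Hom C G (D i)) : c i \oc g = c i \oc h ->
  exists j (u : Hom cJ i j), fmap D u \oc g = fmap D u \oc h.
Proof.
move=> E.
(* [R k x] says that [x] and [g] agree at a later stage. It descends to a predicate [r] on
   [Hom C G X], true at [c i \oc g], hence at [c i \oc h]. *)
pose R k (x : Hom C G (D k)) := exists l (u : Hom cJ i l) (v : Hom cJ k l),
  fmap D u \oc g = fmap D v \oc x.
have [_ /(_ Prop R)] := fpG fJ cX.
case=> [j k w|r [rE _]].
  apply: funext => x /=; rewrite propeqE; split=> -[l [u [v e]]].
    by exists l, u, (v \oc w); rewrite fmapM -compmA.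
  have [m [[a _] [b _]]] := filtered_ub fJ l k.
  have [n [t tE]] := filtered_coeq fJ (a \oc v) (b \oc w).
  exists n, (t \oc (a \oc u)), (t \oc b).
  rewrite [RHS]compmA -fmapM -(compmA t b w) -tE !fmapM -!compmA.
  by rewrite e.
have rg : r (c i \oc g).
  by have /= -> := congr1 (fun f => f g) (rE i); exists i, (idm i), (idm i).
rewrite E in rg; have /= e := congr1 (fun f => f h) (rE i).
rewrite e in rg => {e}; case: rg => l [u [v e]].
have [n [t tE]] := filtered_coeq fJ u v.
by exists n, (t \oc u); rewrite {2}tE !fmapM -!compmA e.
Qed.
End FinitelyPresented.

Lemma colimit_eq (Ob : Type) (C : category Ob) (J : Type) (cJ : category J)
    (D : functor cJ C) (X : Ob) (c : forall i, Hom C (D i) X) :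
  is_colimit c ->
  forall (Y : Ob) (u v : Hom C X Y), (forall i, u \oc c i = v \oc c i) -> u = v.
Proof.
move=> [cc cU] Y u v E; have [|h [_ hU]] := cU Y (fun i => u \oc c i).
  by move=> i j w; rewrite -compmA cc.
by rewrite -(hU u) // -(hU v).
Qed.

Lemma product_eq (Ob : Type) (C : category Ob) (I : Type) (X : I -> Ob) (P : Ob)
    (p : forall i, Hom C P (X i)) :
  is_product p ->
  forall (Y : Ob) (u v : Hom C Y P), (forall i, p i \oc u = p i \oc v) -> u = v.
Proof.
move=> pP Y u v E; have [h [_ hU]] := pP Y (fun i => p i \oc u).
by rewrite -(hU u) // -(hU v).
Qed.

(* The last three fields say that the [G s] are dense in [A]: sending [Y] to the
   presheaf [s |-> Hom (G s) Y] is fully faithful with flat values. *)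
Record fp_dense (Ob : Type) (C : category Ob) (S : Small) (G : S -> Ob) : Prop :=
  FpDense {
  fpd_fp : forall s, finitely_presented C (G s);
  fpd_ext : forall (X Y : Ob) (u v : Hom C X Y),
    (forall s (g : Hom C (G s) X), u \oc g = v \oc g) -> u = v;
  fpd_ub : forall X s t (g : Hom C (G s) X) (h : Hom C (G t) X),
    exists r (z : Hom C (G r) X) (a : Hom C (G s) (G r)) (b : Hom C (G t) (G r)),
      z \oc a = g /\ z \oc b = h;
  fpd_coeq : forall X s t (z : Hom C (G t) X) (a b : Hom C (G s) (G t)),
    z \oc a = z \oc b ->
    exists r (z' : Hom C (G r) X) (k : Hom C (G t) (G r)),
      z' \oc k = z /\ k \oc a = k \oc b;
  fpd_glue : forall X Y (phi : forall s, Hom C (G s) X -> Hom C (G s) Y),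
    (forall s t (g : Hom C (G s) X) (a : Hom C (G t) (G s)),
      phi t (g \oc a) = phi s g \oc a) ->
    exists h : Hom C X Y, forall s (g : Hom C (G s) X), h \oc g = phi s g
}.

Lemma lfp_dense (Ob : Type) (A : preadditive Ob) :
  locally_finitely_presented A ->
  exists (S : Small) (G : S -> Ob), fp_dense A G.
Proof.
move=> [_ _ [S [G [Gfp Gall]]] pres]; exists S, G.
(* The presenting diagram is kept as it is; the isomorphisms [e] and [e'] pass between its objects
   and their representatives [G (s i)]. *)
have pres' X : exists (J : Small) (cJ : category J) (D : functor cJ A)
    (c : forall i, Hom A (D i) X) (s : J -> S)
    (e : forall i, Hom A (D i) (G (s i))) (e' : forall i, Hom A (G (s i)) (D i)),
    [/\ filtered cJ, is_colimit c, forall i, e' i \oc e i = idm (D i)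
      & forall i, e i \oc e' i = idm (G (s i))].
  have [J [cJ [D [c [fJ Dfp cX]]]]] := pres X.
  have /choice[s Ds] : forall i, exists s, isomorphic A (D i) (G s).
    by move=> i; apply: Gall.
  have ee i : exists p : Hom A (D i) (G (s i)) * Hom A (G (s i)) (D i),
      p.2 \oc p.1 = idm (D i) /\ p.1 \oc p.2 = idm (G (s i)).
    by have [e [e' ?]] := Ds i; exists (e, e').
  pose p i := projT1 (cid (ee i)).
  exists J, cJ, D, c, s, (fun i => (p i).1), (fun i => (p i).2).
  by split=> // i; have [] := projT2 (cid (ee i)).
split=> //.
- move=> X Y u v E.
  have [J [cJ [D [c [s [e [e' [fJ cX e1 e2]]]]]]]] := pres' X.
  apply: (colimit_eq cX) => i.
  by rewrite -[c i]compm1 -(e1 i) !compmA -2!(compmA _ (c i)) E.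
- move=> X s1 s2 g h.
  have [J [cJ [D [c [s [e [e' [fJ cX e1 e2]]]]]]]] := pres' X.
  have [i [g' ->]] := fp_factor (Gfp s1) fJ cX g.
  have [j [h' ->]] := fp_factor (Gfp s2) fJ cX h.
  have [k [[u _] [v _]]] := filtered_ub fJ i j.
  exists (s k), (c k \oc e' k), (e k \oc (fmap D u \oc g')), (e k \oc (fmap D v \oc h')).
  have Q Z (x : Hom A Z (D k)) : c k \oc e' k \oc (e k \oc x) = c k \oc x.
    by rewrite -compmA (compmA (e' k)) e1 comp1m.
  by rewrite !Q !compmA !cX.1.
- move=> X s1 s2 z a b E.
  have [J [cJ [D [c [s [e [e' [fJ cX e1 e2]]]]]]]] := pres' X.
  have [i [z' zE]] := fp_factor (Gfp s2) fJ cX z.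
  have [|j [u uE]] := fp_eq (Gfp s1) fJ cX (g := z' \oc a) (h := z' \oc b).
    by rewrite !compmA -zE.
  exists (s j), (c j \oc e' j), (e j \oc (fmap D u \oc z')); split.
    by rewrite -compmA (compmA (e' j)) e1 comp1m compmA cX.1.
  by rewrite -!compmA uE.
- move=> X Y phi nat_phi.
  have [J [cJ [D [c [s [e [e' [fJ cX e1 e2]]]]]]]] := pres' X.
  (* The value of [phi] at [c i], transported from [G (s i)] to [D i]; naturality makes [d] a
     cocone. *)
  pose d i := phi _ (c i \oc e' i) \oc e i.
  have [|h [hE _]] := cX.2 Y d.
    move=> i j u.
    have -> : d j \oc fmap D u = d j \oc fmap D u \oc (e' i \oc e i).
      by rewrite e1 compm1.
    rewrite /d -(compmA _ (e j)) compmA -(compmA _ _ (e' i)) -nat_phi.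
    by rewrite -!compmA (compmA (e' j)) e1 comp1m (compmA (c j)) cX.1.
  exists h => t g; have [i [g' ->]] := fp_factor (Gfp t) fJ cX g.
  rewrite compmA hE /d -compmA -nat_phi.
  by rewrite -compmA (compmA (e' i)) e1 comp1m.
Qed.

(** * Splitting of idempotents; retracts as direct summands *)

Section SplitIdempotents.
Variables (Ob : Type) (A : preadditive Ob) (cocA : cocomplete A).

Section OneObjectDiagram.
Variables (P : Ob) (e : Hom A P P).
Hypothesis ee : e \oc e = e.

(** A functor from this one-object category is an object with an idempotent, the image of
    [false]. *)
Definition free_idempotent : category unit :=
  @Category unit (fun _ _ => bool) (fun=> true) (fun _ _ _ => andb)
    (fun _ _ => andTb) (fun _ _ => andbT) (fun _ _ _ _ => andbA).

Let act (b : bool) := if b then idm P else e.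

Lemma actM b b' : act (b && b') = act b \oc act b'.
Proof. by case: b b' => [] [] /=; rewrite ?comp1m ?compm1 ?ee. Qed.

Definition idempotent_diagram : functor free_idempotent A :=
  @Functor unit Ob free_idempotent A (fun=> P) (fun _ _ b => act b)
    (fun=> erefl) (fun _ _ _ b b' => actM b b').

(** The colimit is the coequaliser of [e] and the identity; [e] is itself a cocone, and factoring it
    through the colimit gives the splitting. *)
Lemma idempotent_splits :
  exists (X : Ob) (i : Hom A X P) (p : Hom A P X), i \oc p = e /\ p \oc i = idm X.
Proof.
have [X [c cX]] := cocA idempotent_diagram.
have pe : c tt \oc e = c tt by have := cX.1 tt tt false.
have [|i [iE _]] := cX.2 P (fun=> e).
  by move=> [] [] [] /=; rewrite ?compm1 ?ee.
exists X, i, (c tt); split; first exact: iE.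
by apply: (colimit_eq cX) => -[]; rewrite -compmA iE comp1m.
Qed.
End OneObjectDiagram.

(** The complement is the image of the idempotent [idm P - s \oc f], which splits. *)
Lemma retract_summand (X P : Ob) (s : Hom A X P) (f : Hom A P X) :
  f \oc s = idm X -> direct_summand A X P.
Proof.
move=> fs; pose e : Hom A P P := idm P - s \oc f.
have fe : f \oc e = 0 by rewrite /e comp_subr compm1 compmA fs comp1m subrr.
have es : e \oc s = 0 by rewrite /e comp_subl comp1m -compmA fs compm1 subrr.
have ee : e \oc e = e by rewrite {1}/e comp_subl comp1m -compmA fe comp_0r subr0.
have [Y [i [p [ip pi]]]] := idempotent_splits ee.
exists Y, s, i, f, p; split=> //.
- by rewrite -(compm1 i) -pi (compmA i) ip compmA fe comp_0l.
- by rewrite -(comp1m p) -pi -(compmA p) ip -compmA es comp_0r.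
- by rewrite ip /e addrC subrK.
Qed.

End SplitIdempotents.

(** * Copowers and finite supports *)

Section Copower.
Variables (Ob : Type) (A : preadditive Ob) (cocA : cocomplete A).
Variables (M : Ob) (J : Small).

Let eJ : eqType := HB.pack J (gen_eqMixin J).

Definition discrete_category : category J :=
  @Category J (fun i j => i = j) (@erefl J) (fun _ _ _ v u => etrans u v)
    (fun _ _ _ => Prop_irrelevance _ _) (fun _ _ _ => Prop_irrelevance _ _)
    (fun _ _ _ _ _ _ _ => Prop_irrelevance _ _).

Definition constant_functor : functor discrete_category A :=
  @Functor J Ob discrete_category A (fun=> M) (fun _ _ _ => idm M)
    (fun=> erefl) (fun _ _ _ _ _ => esym (comp1m (idm M))).

(** The flag [true], allowed only for [K = L], marks the identity; [false] marks an inclusion. *)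
Definition listed_hom (K L : seq eJ) : Type :=
  {b : bool | (b ==> (K == L)) && all [in L] K}.

Lemma listed_id (K : seq eJ) : (true ==> (K == K)) && all [in K] K.
Proof. by rewrite eqxx; apply/(@allP eJ). Qed.

Lemma listed_comp (K L N : seq eJ) (v : listed_hom L N) (u : listed_hom K L) :
  ((val v && val u) ==> (K == N)) && all [in N] K.
Proof.
case: v u => [b /andP[/implyP bE /(@allP eJ _ _) LN]]
             [b' /andP[/implyP bE' /(@allP eJ _ _) KL]] /=.
apply/andP; split; last by apply/(@allP eJ) => x xK; exact: (LN x (KL x xK)).
by apply/implyP => /andP[/bE/eqP <-] /bE'.
Qed.

(* Finite lists under inclusion, with a formal non-identity endomorphism [false]
   of each list, so that a functor may act on it by an idempotent. *)
Definition listed_category : category (seq eJ).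
Proof.
refine (@Category (seq eJ) listed_hom (fun K => Sub true (listed_id K))
  (fun K L N v u => Sub (val v && val u) (listed_comp v u)) _ _ _).
- by move=> K L f; apply: val_inj.
- by move=> K L f; apply: val_inj; rewrite /= andbT.
- by move=> K L N O h g f; apply: val_inj; rewrite /= andbA.
Defined.

Lemma listed_filtered : filtered listed_category.
Proof.
have inc (K L : seq eJ) : {subset K <= L} -> Hom listed_category K L.
  by move=> KL; exists false; apply/(@allP eJ).
split.
- by exists [::].
- move=> K L; exists (K ++ L); split.
    by (have : Hom listed_category K (K ++ L) by
         apply: inc => x xK; rewrite mem_cat xK); move=> u; exists u.
  by (have : Hom listed_category L (K ++ L) by
       apply: inc => x xK; rewrite mem_cat xK orbT); move=> u; exists u.
- move=> K L u v; have w : Hom listed_category L L by apply: inc.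
  have LL : (false ==> (L == L)) && all [in L] L by case/andP: (listed_id L).
  (* Composition with this endomorphism turns every flag into [false], so parallel arrows become
     equal. *)
  exists L, (Sub false LL).
  by apply: val_inj.
Qed.

(** The copower [Y] is the filtered colimit of its finite subsums. These are encoded by a constant
    diagram on [Y] where a [false] arrow out of [K] acts by the projection [e K], so that maps from
    finitely presented objects factor through some [e L]. *)
Lemma copower_finite_support :
  exists (Y : Ob) (iota : J -> Hom A M Y) (pi : J -> Hom A Y M),
    [/\ forall j, pi j \oc iota j = idm M,
        forall j k, j <> k -> pi j \oc iota k = 0
      & forall G, finitely_presented A G -> forall g : Hom A G Y,
          finite_set [set j | pi j \oc g <> 0]%classic].
Proof.
have [Y [io Yc]] := cocA constant_functor.
have piP (j : eJ) : exists q : Hom A Y M, forall k : eJ,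
    q \oc io k = if j == k then idm M else 0.
  have [|q [qE _]] := Yc.2 M (fun k : eJ => if j == k then idm M else 0).
    by move=> i k /= ->; rewrite compm1.
  by exists q.
pose pi (j : J) := projT1 (cid (piP j)).
have piE (j k : eJ) : pi j \oc io k = if j == k then idm M else 0.
  by rewrite /pi; case: cid => q /= ->.
(* Without [undup], repeated indices would be counted several times and [e L] would not be
   idempotent. *)
pose e (L : seq eJ) : Hom A Y Y := \sum_(j <- undup L) (io j \oc pi j).
have eio L (j : eJ) : e L \oc io j = if j \in L then io j else 0.
  rewrite /e comp_suml -mem_undup; case: ifP => jL.
    rewrite (bigD1_seq j) ?undup_uniq //= -compmA piE eqxx compm1 big1 ?addr0 //.
    by move=> k kj; rewrite -compmA piE (negbTE kj) comp_0r.
  rewrite big_seq big1 // => k kL; rewrite -compmA piE.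
  by case: eqP => [kj|_]; [rewrite kj jL in kL | rewrite comp_0r].
have ee (K L : seq eJ) : {subset K <= L} -> e L \oc e K = e K.
  move=> KL; apply: (colimit_eq Yc) => j; rewrite -compmA eio.
  by case: ifP => [jK|_]; rewrite ?comp_0r // eio KL.
have pie L (j : eJ) : j \notin L -> pi j \oc e L = 0.
  move=> jL; apply: (colimit_eq Yc) => k; rewrite -compmA eio comp_0l.
  case: ifP => [kL|_]; last by rewrite comp_0r.
  by rewrite piE; case: eqP => // jk; rewrite jk kL in jL.
have dM K L N (v : listed_hom L N) (u : listed_hom K L) :
  (if val v && val u then idm Y else e K) =
  (if val v then idm Y else e L) \oc (if val u then idm Y else e K).
  case: u v => b /= /andP[/implyP bE /(@allP eJ _ _) KL] [b' /= b'E].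
  case: b b' bE b'E => [] [] bE b'E /=; rewrite ?comp1m ?compm1 ?ee //.
  by have /eqP -> := bE isT.
pose D : functor listed_category A :=
  @Functor (seq eJ) Ob listed_category A (fun=> Y)
   (fun K L u => if val u then idm Y else e K) (fun=> erefl) dM.
have DY : is_colimit (D := D) e.
  split=> [K L [b /= /andP[/implyP bE /(@allP eJ _ _) KL]]|Z d dc].
    by case: b bE => bE; rewrite ?ee //; have /eqP -> := bE isT; rewrite compm1.
  (* For [K = L] this gives [d L \oc e L = d L]: thanks to the formal endomorphism, a cocone only
     sees the image of [e L]. *)
  have dE K L : {subset K <= L} -> d L \oc e K = d K.
    move=> KL; have inc : (false ==> (K == L)) && all [in L] K by apply/(@allP eJ).
    exact: (dc K L (Sub false inc)).
  have [|h [hE _]] := Yc.2 Z (fun k : eJ => d [:: k] \oc io k).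
    by move=> i j /= ->; rewrite compm1.
  exists h; split=> [L|h' h'E].
    apply: (colimit_eq Yc) => j; rewrite -compmA eio -[d L](dE L L) // -compmA eio.
    case: ifP => jL; last by rewrite !comp_0r.
    rewrite hE -(dE [:: j] L) -?compmA ?eio ?mem_head //.
    by move=> x; rewrite inE => /eqP ->.
  apply: (colimit_eq Yc) => j; rewrite hE -(h'E [:: j]) -compmA eio.
  by rewrite mem_head.
exists Y, io, pi; split.
- by move=> j; have := piE j j; rewrite eqxx.
- by move=> j k jk; have := piE j k; case: eqP.
- move=> G Gfp g; have [L [h ->]] := fp_factor Gfp listed_filtered DY g.
  apply: (@sub_finite_set _ _ [set` L]%classic); last exact: (@finite_seq eJ).
  by move=> j /=; apply: contra_notP => /negP jL; rewrite compmA pie // comp_0l.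
Qed.
End Copower.

(** * Subfunctors of Hom(G, -) and Chase's lemma *)

(** An abstract form of pp-definable subgroups, keeping functoriality and compatibility with
    products. *)
Record subgroup_functor (Ob : Type) (A : preadditive Ob) (G : Ob)
    (U : forall Y, Hom A G Y -> Prop) : Prop := SubgroupFunctor {
  sf_0 : forall Y, U Y 0;
  sf_sub : forall Y x y, U Y x -> U Y y -> U Y (x - y);
  sf_comp : forall Y Z (h : Hom A Y Z) x, U Y x -> U Z (h \oc x);
  sf_product : forall (I : Small) (Y : I -> Ob) P (p : forall i, Hom A P (Y i)),
    is_product p -> forall x, (forall i, U (Y i) (p i \oc x)) -> U P x
}.

Lemma sf_add (Ob : Type) (A : preadditive Ob) (G : Ob)
    (U : forall Y, Hom A G Y -> Prop) : subgroup_functor U ->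
  forall Y x y, U Y x -> U Y y -> U Y (x + y).
Proof.
move=> sU Y x y xU yU; rewrite -[y]opprK; apply: sf_sub => //.
by rewrite -sub0r; apply: sf_sub => //; apply: sf_0.
Qed.

Section ChaseLemma.
Local Open Scope classical_set_scope.
Variables (Ob : Type) (A : preadditive Ob) (G M P : Ob).
Variables (I J : Small) (p : I -> Hom A P M) (q : J -> Hom A P M).
Variable U : nat -> forall Y, Hom A G Y -> Prop.
Arguments U : clear implicits.
Hypothesis productP : is_product (X := fun=> M) p.
Hypothesis q_fin : forall x : Hom A G P, finite_set [set j | q j \oc x <> 0].
Hypothesis sfU : forall n, subgroup_functor (U n).
Hypothesis U_decr : forall n Y x, U n.+1 Y x -> U n Y x.

Lemma U_le m n Y x : (m <= n)%N -> U n Y x -> U m Y x.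
Proof.
move=> /subnK <-; elim: (n - m)%N => [//|k IH]; rewrite addSn => /U_decr.
exact: IH.
Qed.

Definition supported (S : set I) (x : Hom A G P) : Prop :=
  forall i, ~ S i -> p i \oc x = 0.

(** The failure of Chase's conclusion on [S]: no [U n] has its elements supported in [S] mapped by
    [q] into finitely many coordinates modulo the intersection of the [U m]. *)
Definition bad (S : set I) : Prop :=
  forall n (L : set J), finite_set L -> exists x : Hom A G P,
    [/\ U n P x, supported S x
      & exists j, ~ L j /\ exists m, ~ U m M (q j \oc x)].

(* Chase's argument: if all the [B n] were bad, one could add up elements
   [x_ k] of [U (n_ k)] supported in [B (n_ k)] to an element with infinitely
   many nonzero coordinates [q (j_ k)]. *)
Lemma chase (B : nat -> set I) : (forall n, B n.+1 `<=` B n) ->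
  (forall i, exists n, ~ B n i) -> ~ (forall n, bad (B n)).
Proof.
move=> B_decr B_empty B_bad.
have B_le m n : (m <= n)%N -> B n `<=` B m.
  move=> /subnK <-; elim: (n - m)%N => [//|k IH]; rewrite addSn => i /B_decr.
  exact: IH.
have /choice[F FP] : forall s : nat * set J, exists r : Hom A G P * J * nat,
    finite_set s.2 -> [/\ U s.1 P r.1.1, supported (B s.1) r.1.1,
      ~ s.2 r.1.2 & ~ U r.2 M (q r.1.2 \oc r.1.1)].
  move=> [n L]; have [fin|nfin] := pselect (finite_set L).
    by have [x [? ? [j [? [m ?]]]]] := B_bad n n L fin; exists (x, j, m).
  (* For infinite [L] the claim is vacuous; badness only supplies some triple. *)
  have [x [_ _ [j [_ [m _]]]]] := B_bad n n set0 (finite_set0 _).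
  by exists (x, j, m) => /nfin.
pose x s := (F s).1.1; pose jj s := (F s).1.2; pose mm s := (F s).2.
(* The new level is above the old one and at least the witness [m]; the new finite set absorbs the
   support of [x] under [q] and the index [j]. *)
pose next s := (maxn s.1.+1 (mm s),
  s.2 `|` [set j | q j \oc x s <> 0] `|` [set jj s]).
pose st k := iter k next (0%N, set0).
have st_fin k : finite_set (st k).2.
  elim: k => [|k IH] /=; first exact: finite_set0.
  by rewrite !finite_setU; split; [split=> //; apply: q_fin|apply: finite_set1].
have stP k := FP (st k) (st_fin k).
have n_lt k : ((st k).1 < (st k.+1).1)%N by rewrite /= leq_maxl.
have n_ge k : (k <= (st k).1)%N by elim: k => // k IH; apply: leq_ltn_trans (n_lt k).
have n_le k l : (k <= l)%N -> ((st k).1 <= (st l).1)%N.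
  move=> /subnK <-; elim: (l - k)%N => // d IH; rewrite addSn.
  exact: leq_trans IH (ltnW (n_lt _)).
have m_le k : (mm (st k) <= (st k.+1).1)%N by rewrite /= leq_maxr.
have L_le k l : (k <= l)%N -> (st k).2 `<=` (st l).2.
  move=> /subnK <-; elim: (l - k)%N => // d IH; rewrite addSn => j /IH.
  by move=> ?; left; left.
have j_in k l : (k < l)%N -> (st l).2 (jj (st k)).
  by move=> kl; apply: (L_le _ _ kl); right.
have x_supp k l : (k < l)%N -> q (jj (st l)) \oc x (st k) = 0.
  move=> kl; have [_ _ + _] := stP l; apply: contra_notP => nz.
  by apply: (L_le _ _ kl); left; right => /nz.
have [N NP] := choice B_empty.
have x_vanish i k : (N i <= k)%N -> p i \oc x (st k) = 0.
  move=> ik; have [_ + _ _] := stP k; apply => Bi; apply: (NP i).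
  exact: (B_le _ _ (leq_trans ik (n_ge k))).
(* From [k = N i] on, [x (st k)] has coordinate [i] zero, so the infinite sum of the [x (st k)]
   makes sense coordinatewise. *)
have [y [yE _]] := productP (fun i => \sum_(0 <= k < N i) (p i \oc x (st k))).
have U_sum n (Q : nat -> Hom A G M) a b :
    (forall k, (a <= k)%N -> U n M (Q k)) -> U n M (\sum_(a <= k < b) Q k).
  move=> QU; rewrite big_seq_cond; elim/big_ind: _; first exact: sf_0.
    by move=> *; apply: sf_add.
  by move=> k; rewrite mem_index_iota andbT => /andP[ak _]; apply: QU.
have tail k : U (st k.+1).1 P (y - \sum_(0 <= l < k.+1) x (st l)).
  apply: (sf_product (sfU _) productP) => i.
  rewrite comp_subr yE comp_sumr; set K := maxn (N i) k.+1.
  have -> : \sum_(0 <= l < N i) (p i \oc x (st l)) =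
            \sum_(0 <= l < K) (p i \oc x (st l)).
    rewrite (@big_cat_nat _ _ _ (N i) 0 K) ?leq_maxl //= [X in _ + X]big_nat.
    by rewrite [X in _ + X]big1 ?addr0 // => l /andP[/x_vanish].
  rewrite (@big_cat_nat _ _ _ k.+1 0 K) ?leq_maxr //= addrAC subrr add0r.
  apply: U_sum => l kl; apply: sf_comp => //.
  by have [xU _ _ _] := stP l; apply: U_le (n_le k.+1 l kl) xU.
(* At the index [jj (st k)] the terms before [x (st k)] vanish and the tail lies in [U (mm (st k))];
   if [y] vanished there, the coordinate of [x (st k)] would lie in that subgroup. *)
have y_nz k : q (jj (st k)) \oc y <> 0.
  move=> y0; have [_ _ _] := stP k; apply.
  have := sf_comp (sfU _) (q (jj (st k))) (U_le (m_le k) (tail k)).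
  rewrite comp_subr y0 sub0r comp_sumr big_nat_recr //= big_nat big1 ?add0r.
    move=> H; rewrite -[_ \oc _]opprK -sub0r.
    by apply: sf_sub => //; apply: sf_0.
  by move=> l /andP[_ /x_supp].
have j_inj : injective (fun k => jj (st k)).
  move=> k l kl; apply/eqP; case: ltngtP => // lt.
    by have [_ _ + _] := stP l; case; rewrite -/(jj (st l)) -kl; apply: j_in.
  by have [_ _ + _] := stP k; case; rewrite -/(jj (st k)) kl; apply: j_in.
apply: infinite_nat.
have := @finite_preimage _ _ [set j | q j \oc y <> 0] (fun k => jj (st k))
  (in2W j_inj) (q_fin y).
by apply: sub_finite_set => k _; apply: y_nz.
Qed.

Lemma exists_restriction (S : set I) (x : Hom A G P) : exists y : Hom A G P,
  (forall i, S i -> p i \oc y = p i \oc x) /\ supported S y.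
Proof.
have [y [yE _]] := productP (fun i => if asbool (S i) then p i \oc x else 0).
by exists y; split=> i Si; rewrite yE; case: asboolP.
Qed.

Lemma bad_subset (S T : set I) : S `<=` T -> bad S -> bad T.
Proof.
move=> ST bS n L Lf; have [x [xU xS xj]] := bS n L Lf; exists x; split=> // i Ti.
by apply: xS => /ST.
Qed.

Lemma not_bad0 : ~ bad set0.
Proof.
move=> /(_ 0%N set0 (finite_set0 _))[x [_ x0 [j [_ [m]]]]]; apply.
have -> : x = 0 by apply: (product_eq productP) => i; rewrite comp_0r x0.
by rewrite comp_0r; apply: sf_0.
Qed.

(** An element supported in the union is its restriction to [S], which stays in each [U k] by
    [sf_product], plus a remainder supported in [T]. One of the two keeps a coordinate outside
    [U m]. *)
Lemma bad_setU (S T : set I) : bad (S `|` T) -> bad S \/ bad T.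
Proof.
move=> bST; apply: contrapT => /not_orP[].
move=> /existsNP[n /existsNP[L /not_implyP[Lf nS]]].
move=> /existsNP[n' /existsNP[L' /not_implyP[Lf' nT]]].
have [|x [xU xST [j [jL [m xm]]]]] := bST (maxn n n') (L `|` L').
  by rewrite finite_setU.
have [y [yE yS]] := exists_restriction S x.
have zU k : U k P x -> U k P y.
  move=> xk; apply: (sf_product (sfU _) productP) => i.
  have [Si|/yS ->] := pselect (S i); last exact: sf_0.
  by rewrite yE //; apply: sf_comp.
apply: xm; have -> : x = y + (x - y) by rewrite addrC subrK.
rewrite comp_addr; apply: sf_add => //; apply: contrapT => yj.
  apply: nS; exists y; split=> //; first by apply/zU/(U_le (leq_maxl _ n')).
  by exists j; split; [move=> jL'; apply: jL; left | exists m].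
apply: nT; exists (x - y); split.
- by apply: sf_sub => //; [|apply: zU]; apply: U_le xU; apply: leq_maxr.
- move=> i Ti; rewrite comp_subr; have [Si|nSi] := pselect (S i).
    by rewrite yE // subrr.
  by rewrite yS // subr0 xST // => -[].
- by exists j; split; [move=> jL'; apply: jL; right | exists m].
Qed.

Lemma bad_fin_bigcup (F : nat -> set I) n :
  bad [set i | exists k, (k < n)%N /\ F k i] -> exists k, bad (F k).
Proof.
elim: n => [b|n IH b]; first by case: not_bad0; apply: bad_subset b => i [k []].
have [|/IH//|?] := @bad_setU [set i | exists k, (k < n)%N /\ F k i] (F n).
  apply: bad_subset b => i [k []]; rewrite ltnS leq_eqVlt => /orP[/eqP ->|kn ?].
    by right.
  by left; exists k.
by exists n.
Qed.

(** If no [F n] were bad, neither would be the finite unions, so all tails would be bad; but by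
    disjointness the tails decrease to the empty set. *)
Lemma bad_bigcup (F : nat -> set I) : trivIset setT F ->
  bad (\bigcup_n F n) -> exists n, bad (F n).
Proof.
move=> tF bF; apply: contrapT => nF.
apply: (@chase (fun n => [set i | exists k, (n <= k)%N /\ F k i])).
- by move=> n i [k [nk Fi]]; exists k; split=> //; apply: ltnW.
- move=> i; have [[k Fki]|nFi] := pselect (exists k, F k i).
    exists k.+1 => -[l [kl Fli]]; have E : k = l by apply: tF => //; exists i.
    by rewrite E ltnn in kl.
  by exists 0%N => -[k [_ Fki]]; apply: nFi; exists k.
- move=> n; have [|//|/bad_fin_bigcup//] := @bad_setU
      [set i | exists k, (n <= k)%N /\ F k i]
      [set i | exists k, (k < n)%N /\ F k i].
  apply: bad_subset bF => i [k _ Fki].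
  by case: (leqP n k) => nk; [left|right]; exists k.
Qed.

(* A bad set that is not the disjoint union of two bad sets carries a
   two-valued measure, whose null sets are the sets that are not bad. *)
Lemma finite_bad_complement :
  (forall I : Small, ~ omega_measurable I) ->
  exists F : set I, finite_set F /\ ~ bad (~` F).
Proof.
move=> nomeas; pose F := [set i | bad [set i]]; exists F; split.
  (* Infinitely many bad points would give a sequence whose tails are all bad. *)
  apply: contrapT => /infiniteP/card_leP[f0].
  pose f (n : nat) := val (f0 (exist _ n (mem_set (Logic.I : [set: nat] n)))).
  have f_inj k l : f k = f l -> k = l.
    by move=> /val_inj E; have [] := inj (f := f0) (mem_set Logic.I) (mem_set Logic.I) E.
  have fF n : F (f n) by exact: set_valP.
  apply: (@chase (fun n => [set i | exists k, (n <= k)%N /\ i = f k])).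
  - by move=> n i [k [nk ->]]; exists k; split=> //; apply: ltnW.
  - move=> i; have [[k ->]|nfi] := pselect (exists k, i = f k).
      by exists k.+1 => -[l [kl /f_inj E]]; rewrite E ltnn in kl.
    by exists 0%N => -[k [_ E]]; apply: nfi; exists k.
  - move=> n; have := fF n.
    by apply: bad_subset => i ->; exists n.
move=> bF.
have [S [SF bS atom]] : exists S : set I, [/\ S `<=` ~` F, bad S
    & forall T, bad (S `&` T) -> ~ bad (S `\` T)].
  apply: contrapT => /forallNP nS.
  have /choice[g gP] : forall S : set I, exists T, S `<=` ~` F -> bad S ->
      bad (S `&` T) /\ bad (S `\` T).
    move=> S; apply: contrapT => /forallNP nT; apply: (nS S).
    have /not_implyP[SF /not_implyP[bS _]] := nT setT.
    split=> // T bST bSDT; apply: (nT T) => _ _; split=> //.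
  (* Each splitting keeps one bad half and discards another. With their common intersection removed,
     the [st k] decrease to the empty set, and the [k]-th still contains the half discarded at step
     [k]. *)
  pose st k := iter k (fun S => S `&` g S) (~` F).
  have stP k : st k `<=` ~` F /\ bad (st k).
    elim: k => [|k [stF bst]]; first by split.
    split; last by have [] := gP _ stF bst.
    by move=> i [/stF].
  apply: (@chase (fun k => [set i | st k i /\ ~ forall m, st m i])).
  - by move=> k i [[? _] ?].
  - move=> i; have [sti|/existsNP[m nsti]] := pselect (forall m, st m i).
      by exists 0%N => -[_]; apply.
    by exists m => -[].
  - move=> k; have [_] := gP _ (stP k).1 (stP k).2.
    by apply: bad_subset => i [ski ngi]; split=> // /(_ k.+1)[].
have atomC T T' : T `&` T' = set0 -> bad (S `&` T) -> ~ bad (S `&` T').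
  move=> TT' /atom + bST'; apply; apply: bad_subset bST' => i [Si T'i].
  by split=> // Ti; have : set0 i by rewrite -TT'.
pose mu (A : set I) : nat := `[< bad (S `&` A) >].
apply: (nomeas I); split; last (exists mu; split).
(* Were [I] countable, some point of [S] would be bad, but [S] avoids [F]. *)
- move=> /countable_injP[c c_inj].
  have : exists n, bad (S `&` [set i | c i = n]).
    apply: bad_bigcup => [m n _ _ [i [[_ <-] [_ <-]]]//|].
    by apply: bad_subset bS => i Si; exists (c i).
  move=> [n]; have [[i ci]|nc] := pselect (exists i, c i = n).
    have [Si|nSi] := pselect (S i).
      move=> b; apply: (SF i Si); apply: bad_subset b => j [_ cj].
      by apply: c_inj; rewrite ?inE // cj.
    move=> b; apply: not_bad0; apply: bad_subset b => j [Sj cj].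
    by apply: nSi; rewrite (c_inj i j) ?inE // ci.
  by move=> b; apply: not_bad0; apply: bad_subset b => j [_ cj]; apply: nc; exists j.
- by move=> T; rewrite /mu; case: asboolP; [right|left].
- move=> T tT; apply: cvg_near_cst.
  (* If the union is bad in [S], exactly one [T n] is, and the partial sums are 1 from [n.+1] on;
     otherwise they are all 0. *)
  have [b|nb] := pselect (bad (S `&` \bigcup_n T n)).
    have [n bn] : exists n, bad (S `&` T n).
      apply: bad_bigcup => [i j _ _ [x [[_ Tix] [_ Tjx]]]|].
        by apply: tT => //; exists x.
      by rewrite -setI_bigcupr.
    exists n.+1 => // k /= nk; rewrite /mu (asboolT b).
    rewrite (bigD1_seq n) ?mem_index_iota ?iota_uniq //= asboolT // big1 ?addn0 //.
    move=> i /eqP ni; rewrite asboolF //; apply: (atomC _ _ _ bn).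
    apply: contrapT => /eqP/set0P TT; apply: ni; apply: tT => //.
    by rewrite setIC.
  exists 0%N => // k _; rewrite /mu (asboolF nb) big1 // => i _.
  rewrite asboolF //; apply: contra_not nb; apply: bad_subset => x [Sx Tx].
  by split=> //; exists i.
- by rewrite /mu setIT asboolT.
- move=> i; rewrite /mu asboolF //; have [Si|nSi] := pselect (S i).
    by move=> b; apply: (SF i Si); apply: bad_subset b => j [].
  by move=> b; apply: not_bad0; apply: bad_subset b => j [Sj ji]; apply: nSi; rewrite -ji.
Qed.
End ChaseLemma.

(** * Precovers and the descending chain condition *)

Section Precovers.
Variables (Ob : Type) (A : preadditive Ob) (cocA : cocomplete A) (M : Ob).

Lemma Prod_self : Prod A M M.
Proof.
exists unit, M, (fun=> idm M); split.
  move=> Y f; exists (f tt); split=> [[]|h hE]; first by rewrite comp1m.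
  by rewrite -(hE tt) comp1m.
exact: (retract_summand cocA (comp1m (idm M))).
Qed.

(** Composing a precover with the retraction of a power onto its source keeps the lifting
    property. *)
Lemma precover_by_power (Y : Ob) : precovering A (Prod A M) ->
  exists (I : Small) (P : Ob) (p : I -> Hom A P M) (f : Hom A P Y),
    is_product (X := fun=> M) p /\
    forall X (g : Hom A X Y), Prod A M X -> exists h : Hom A X P, g = f \oc h.
Proof.
move=> /(_ Y)[X [f [[I [P [p [pP [Z [s [_ [r [_ [rs _ _ _ _]]]]]]]]]] fX]]].
exists I, P, p, (f \oc r); split=> // X' g X'M; have [h ->] := fX X' g X'M.
by exists (s \oc h); rewrite compmA -(compmA f) rs compm1.
Qed.
End Precovers.

(** Cantor's diagonal argument. *)
Lemma no_powerset_injection (T : Type) (f : (T -> Prop) -> T) : ~ injective f.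
Proof.
move=> f_inj; pose D x := exists B : T -> Prop, f B = x /\ ~ B x.
have nD : ~ D (f D) by move=> /[dup] DfD [B [/f_inj -> nB]].
by apply: (nD); exists D.
Qed.

Section DescendingChains.
Variables (Ob : Type) (A : preadditive Ob) (cocA : cocomplete A) (M : Ob).
Hypothesis no_measurable : forall I : Small, ~ omega_measurable I.
Hypothesis precM : precovering A (Prod A M).

Lemma subgroup_functor_dcc (G : Ob) (U : nat -> forall Y, Hom A G Y -> Prop) :
  finitely_presented A G -> (forall n, subgroup_functor (U n)) ->
  (forall n Y x, U n.+1 Y x -> U n Y x) ->
  exists n0, forall n x, U n0 M x -> U n M x.
Proof.
move=> Gfp sfU U_decr; apply: contrapT => nstat.
have {}nstat n0 : exists (x : Hom A G M), U n0 M x /\ exists n, ~ U n M x.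
  apply: contrapT => H; apply: nstat; exists n0 => n x xU.
  by apply: contrapT => nx; apply: H; exists x; split=> //; exists n.
(* [T] has room to code the points of the finite set [L] by numbers and every other [j] by the
   coordinates of an element on the finite set [F]; its power set [J] is too large for such a code
   to be injective. *)
pose T : Small := (nat + (nat -> Hom A G M -> Prop))%type.
pose J : Small := T -> Prop.
have [Y [iota [pi [piK pi0 pi_fin]]]] := copower_finite_support cocA M J.
have [I [P [p [f [productP fP]]]]] := precover_by_power Y precM.
pose q j := pi j \oc f.
have q_fin (x : Hom A G P) : finite_set [set j | q j \oc x <> 0]%classic.
  have := pi_fin G Gfp (f \oc x).
  by apply: sub_finite_set => j /=; rewrite /q compmA.
have [F [Ffin nbF]] := finite_bad_complement productP q_fin sfU U_decr no_measurable.
move: nbF => /existsNP[n0 /existsNP[L /not_implyP[Lfin nbF]]].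
have [u [u0 [n1 u1]]] := nstat n0.
have /choice[h hE] : forall j, exists h : Hom A M P, iota j = f \oc h.
  by move=> j; apply/fP/(Prod_self cocA).
have /countable_injP[cF cF_inj] := finite_set_countable Ffin.
have /countable_injP[cL cL_inj] := finite_set_countable Lfin.
pose Phi j k (y : Hom A G M) := exists i, [/\ F i, cF i = k & y = p i \oc (h j \oc u)].
pose psi j : T := if pselect (L j) then inl (cL j) else inr (Phi j).
apply: (@no_powerset_injection T psi) => j k; rewrite /psi.
case: pselect => Lj; case: pselect => Lk //.
  by move=> [] /cL_inj; apply; rewrite inE.
move=> [] E; apply: contrapT => jk.
(* If [j] and [k] have the same code, this difference is supported off [F], while its coordinate at
   [j] is [u], which is not in [U n1]. *)
apply: nbF; exists (h j \oc u - h k \oc u); split.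
- by apply: sf_sub => //; apply: sf_comp.
- move=> i /contrapT Fi; rewrite comp_subr.
  have : Phi j (cF i) (p i \oc (h j \oc u)) by exists i.
  rewrite E => -[i' [Fi' /cF_inj]]; rewrite !inE => -> // ->.
  by rewrite subrr.
- exists j; split=> //; exists n1.
  have qh k' : q j \oc (h k' \oc u) = pi j \oc iota k' \oc u.
    by rewrite hE /q !compmA.
  by rewrite comp_subr !qh piK pi0 // comp1m comp_0l subr0.
Qed.

End DescendingChains.

(** * Splitting of pure epimorphisms under the chain condition *)

Section PureEpimorphisms.
Local Open Scope classical_set_scope.

(** Brings finitely many conditions to one stage: of the factorisations of a map, of a chain in
    Zorn's lemma, of a direct limit. *)
Lemma finite_set_directed (T K : Type) (le : K -> K -> Prop)
    (R : T -> K -> Prop) (L : set T) :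
  finite_set L -> (exists k : K, True) ->
  (forall k k', exists k'', le k k'' /\ le k' k'') ->
  (forall x k k', le k k' -> R x k -> R x k') ->
  (forall x, L x -> exists k, R x k) -> exists k, forall x, L x -> R x k.
Proof.
move=> Lfin [k0 _] dir mono LR; pose eT : eqType := HB.pack T (gen_eqMixin T).
have [s Ls] := (@finite_seqP eT L).1 Lfin.
have {}LR x : x \in s -> exists k, R x k by move=> xs; apply: LR; rewrite Ls.
suff [k kP] : exists k, forall x, x \in s -> R x k.
  by exists k => x; rewrite Ls => /kP.
elim: s LR {Ls} => [|x s IH] LR; first by exists k0.
have [|k kP] := IH; first by move=> y ys; apply: LR; rewrite inE ys orbT.
have [k' k'P] := LR x (mem_head x s).
have [k'' [kk'' k'k'']] := dir k k'.
exists k'' => y; rewrite inE => /orP[/eqP ->|/kP]; first exact: mono k'P.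
exact: mono.
Qed.

Variables (Ob : Type) (A : preadditive Ob) (S : Small) (G : S -> Ob).
Hypothesis denseG : fp_dense A G.

(** The factorisations of [z] through objects [G r] are directed, and each [b] gets identified with
    a fixed [b0] in one of them. *)
Lemma fp_coeq_finite X s t (z : Hom A (G t) X) (x : Hom A (G s) X)
    (B : set (Hom A (G s) (G t))) :
  finite_set B -> (forall b, B b -> z \oc b = x) ->
  exists r (z' : Hom A (G r) X) (k : Hom A (G t) (G r)), z' \oc k = z /\
    forall b b', B b -> B b' -> k \oc b = k \oc b'.
Proof.
move=> Bfin zB; have [[b0 Bb0]|B0] := pselect (exists b, B b); last first.
  exists t, z, (idm _); rewrite compm1; split=> // b b' Bb.
  by case: B0; exists b.
pose K := {r : S & {p : Hom A (G r) X * Hom A (G t) (G r) | p.1 \oc p.2 = z}}.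
pose mkK r (z' : Hom A (G r) X) k (E : z' \oc k = z) : K :=
  existT _ r (exist _ (z', k) E).
pose leK (k k' : K) := exists a : Hom A (G (tag k)) (G (tag k')),
  a \oc (sval (tagged k)).2 = (sval (tagged k')).2.
pose R b (k : K) := (sval (tagged k)).2 \oc b = (sval (tagged k)).2 \oc b0.
have [| | | |[r [[z' k] /= E]] kP] := @finite_set_directed _ K leK R B Bfin.
- by exists (mkK t z (idm _) (compm1 z)).
- move=> [r [[z1 k1] /= E1]] [r' [[z2 k2] /= E2]].
  have [r1 [z3 [a [b [za zb]]]]] := fpd_ub denseG z1 z2.
  have [|r2 [z4 [m [zm mE]]]] := fpd_coeq denseG (z := z3)
      (a := a \oc k1) (b := b \oc k2).
    by rewrite !compmA za zb E1.
  have E : z4 \oc (m \oc (a \oc k1)) = z by rewrite compmA zm compmA za.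
  exists (mkK _ _ _ E); split.
    by exists (m \oc a); rewrite /= compmA.
  by exists (m \oc b); rewrite /= mE compmA.
- move=> b [r [[z1 k1] /= E1]] [r' [[z2 k2] /= E2]] [/= a].
  by rewrite /R /= => <- kb; rewrite -!compmA kb.
- move=> b Bb; have [|r [z' [k [E kE]]]] := fpd_coeq denseG (z := z) (a := b) (b := b0).
    by rewrite !zB.
  by exists (mkK _ _ _ E).
exists r, z', k; split=> // b b' Bb Bb'.
by have := kP b Bb; have := kP b' Bb'; rewrite /R /= => -> ->.
Qed.

Variables (X P : Ob) (f : Hom A P X).

(** A map killing finitely many arrows into [G t] amounts to a map out of their finitely presented
    cokernel, so this is the lifting of maps from finitely presented objects. *)
Definition pure_epi : Prop :=
  forall t (z : Hom A (G t) X) (L : set {s : S & Hom A (G s) (G t)}),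
  finite_set L -> (forall c, L c -> z \oc tagged c = 0) ->
  exists z' : Hom A (G t) P, f \oc z' = z /\ forall c, L c -> z' \oc tagged c = 0.

Hypothesis f_pure : pure_epi.
Hypothesis dccP : forall s (U : nat -> forall Y, Hom A (G s) Y -> Prop),
  (forall n, subgroup_functor (U n)) ->
  (forall n Y x, U n.+1 Y x -> U n Y x) ->
  exists n0, forall n x, U n0 P x -> U n P x.

Let elt : Type := {s : S & Hom A (G s) P}.
(** Such a [c] stands for the equation [w \oc tagged c = tagged (tag c)] in an unknown [w] from
    [G t] to [P]. *)
Let arrow (t : S) : Type := {y : elt & Hom A (G (tag y)) (G t)}.

(* [D] is the graph of a partial section of [f], any finite part of which
   extends to every finitely presented object over [X]. *)
Definition consistent (D : set elt) : Prop :=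
  forall t (z : Hom A (G t) X) (L : set (arrow t)), finite_set L ->
    (forall c, L c -> D (tag c) /\ z \oc tagged c = f \oc tagged (tag c)) ->
    exists w : Hom A (G t) P, f \oc w = z /\
      forall c, L c -> w \oc tagged c = tagged (tag c).

Lemma consistent0 : consistent set0.
Proof.
move=> t z L Lfin LD; have [|c []|w [wz _]] := @f_pure t z set0.
- exact: finite_set0.
- by exists w; split=> // c /LD[].
Qed.

Section Extension.
Variables (D : set elt) (s0 : S) (x0 : Hom A (G s0) X).
Hypothesis consD : consistent D.

(** A finite system of equations with constants in [D], on an object over [X] through which [x0]
    factors. It constrains the possible images of [x0] under an extended section to the set
    [pr_value]. *)
Record probe : Type := Probe {
  pr_obj : S;
  pr_map : Hom A (G pr_obj) X;
  pr_arrows : set (arrow pr_obj);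
  pr_lift : Hom A (G s0) (G pr_obj);
  pr_fin : finite_set pr_arrows;
  pr_arrowsP : forall c, pr_arrows c ->
    D (tag c) /\ pr_map \oc tagged c = f \oc tagged (tag c);
  pr_liftP : pr_map \oc pr_lift = x0
}.

Arguments pr_arrows : clear implicits.

Definition pr_value (h : probe) (y : Hom A (G s0) P) : Prop :=
  exists w : Hom A (G (pr_obj h)) P, [/\ f \oc w = pr_map h,
    forall c, pr_arrows h c -> w \oc tagged c = tagged (tag c)
    & y = w \oc pr_lift h].

(** The homogeneous system, with the map to [X] forgotten; this makes it a pp-definable subfunctor,
    to which the chain condition applies. *)
Definition pr_subgroup (h : probe) (Y : Ob) (g : Hom A (G s0) Y) : Prop :=
  exists v : Hom A (G (pr_obj h)) Y,
    (forall c, pr_arrows h c -> v \oc tagged c = 0) /\ g = v \oc pr_lift h.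

Definition push t t' (k : Hom A (G t) (G t')) (c : arrow t) : arrow t' :=
  existT _ (tag c) (k \oc tagged c).

Definition probe_le (h h' : probe) : Prop :=
  exists k : Hom A (G (pr_obj h)) (G (pr_obj h')),
    [/\ pr_map h' \oc k = pr_map h, k \oc pr_lift h = pr_lift h'
      & forall c, pr_arrows h c -> pr_arrows h' (push k c)].

Lemma probe_le_value h h' y : probe_le h h' -> pr_value h' y -> pr_value h y.
Proof.
move=> [k [k1 k2 k3]] [w [w1 w2 ->]]; exists (w \oc k); split.
- by rewrite compmA w1.
- by move=> c /k3/w2; rewrite /push /= -compmA.
- by rewrite -compmA k2.
Qed.

Lemma probe_le_subgroup h h' Y (g : Hom A (G s0) Y) :
  probe_le h h' -> pr_subgroup h' g -> pr_subgroup h g.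
Proof.
move=> [k [k1 k2 k3]] [w [w2 ->]]; exists (w \oc k); split.
- by move=> c /k3/w2; rewrite /push /= -compmA.
- by rewrite -compmA k2.
Qed.

(** Both objects map to a common one over [X], where the two lifts of [x0] are then coequalised and
    the equations united. *)
Lemma probe_ub h h' : exists h'', probe_le h h'' /\ probe_le h' h''.
Proof.
have [r [z [k [k' [zk zk']]]]] := fpd_ub denseG (pr_map h) (pr_map h').
have [|r' [z' [m [zm mE]]]] := fpd_coeq denseG (z := z)
    (a := k \oc pr_lift h) (b := k' \oc pr_lift h').
  by rewrite !compmA zk zk' !pr_liftP.
pose L := [set push (m \oc k) c | c in pr_arrows h] `|`
          [set push (m \oc k') c | c in pr_arrows h'].
have Lfin : finite_set L.
  by rewrite finite_setU; split; apply/finite_image/pr_fin.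
have LP c : L c -> D (tag c) /\ z' \oc tagged c = f \oc tagged (tag c).
  case=> -[c' /pr_arrowsP[Dc' E] <-] /=; split=> //.
    by rewrite !compmA zm zk.
  by rewrite !compmA zm zk'.
have zl : z' \oc (m \oc k \oc pr_lift h) = x0.
  by rewrite !compmA zm zk pr_liftP.
exists (Probe Lfin LP zl); split.
  exists (m \oc k); split=> //=; first by rewrite compmA zm.
  by move=> c hc; left; exists c.
exists (m \oc k'); split=> //=; first by rewrite compmA zm.
  by rewrite -compmA -mE compmA.
by move=> c hc; right; exists c.
Qed.

Lemma pr_subgroupP h : subgroup_functor (pr_subgroup h).
Proof.
split.
- move=> Y; exists 0; rewrite comp_0l; split=> // c _; exact: comp_0l.
- move=> Y x y [v [v0 ->]] [w [w0 ->]]; exists (v - w); rewrite comp_subl.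
  by split=> // c hc; rewrite comp_subl v0 // w0 // subr0.
- move=> Y Z g x [v [v0 ->]]; exists (g \oc v); split; last exact: compmA.
  by move=> c hc; rewrite -compmA v0 // comp_0r.
- move=> I Y Q p pQ x xU; pose v i := projT1 (cid (xU i)).
  have vP i := projT2 (cid (xU i)); rewrite -/(v _) in vP.
  have [w [wE _]] := pQ _ v; exists w; split.
    move=> c hc; apply: (product_eq pQ) => i; rewrite compmA wE comp_0r.
    by have [->] := vP i.
  apply: (product_eq pQ) => i; rewrite compmA wE.
  by have [_] := vP i.
Qed.

Lemma pr_value_ex h : exists y, pr_value h y.
Proof.
have [w [wz wL]] := consD (pr_fin h) (@pr_arrowsP h).
by exists (w \oc pr_lift h), w.
Qed.

Lemma probe0 : exists h : probe, True.
Proof.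
have z0 : x0 \oc idm _ = x0 by rewrite compm1.
by exists (@Probe s0 x0 set0 (idm _) (finite_set0 _) (fun _ => False_ind _) z0).
Qed.

(* The set of values of a probe is a coset of [ker f] intersected with its
   subgroup, so it only depends on the latter. *)
Lemma pr_value_le h h' : probe_le h h' ->
  (forall x : Hom A (G s0) P, pr_subgroup h x -> pr_subgroup h' x) ->
  forall y, pr_value h y -> pr_value h' y.
Proof.
move=> hh' sub y hy; have [y1 h'y1] := pr_value_ex h'.
have [w1 [fw1 w1L y1E]] := h'y1.
have hy1 := probe_le_value hh' h'y1.
have fv g : pr_value h g -> f \oc g = x0.
  by move=> [w [fw _ ->]]; rewrite compmA fw pr_liftP.
have /sub[v [v0 vE]] : pr_subgroup h (y - y1).
  have [w [fw wL ->]] := hy; have [w' [fw' w'L ->]] := hy1.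
  exists (w - w'); rewrite comp_subl; split=> // c hc.
  by rewrite comp_subl wL // w'L // subrr.
(* The solution [v] need not lie in the kernel of [f]. Purity gives [v'] with the same image under
   [f], killing the equations and [pr_lift h'], so [v - v'] corrects [w1]. *)
pose L : set {s : S & Hom A (G s) (G (pr_obj h'))} :=
  [set existT _ (tag (tag c)) (tagged c) | c in pr_arrows h'] `|`
  [set existT _ s0 (pr_lift h')].
have [||v' [fv' v'L]] := @f_pure _ (f \oc v) L.
- rewrite finite_setU; split; last exact: finite_set1.
  by apply: finite_image; apply: pr_fin.
- move=> c [[c' h'c' <-]|->] /=; rewrite -compmA.
    by rewrite v0 // comp_0r.
  by rewrite -vE comp_subr !fv // subrr.
exists (w1 + (v - v')); split.
- by rewrite comp_addr comp_subr fv' subrr addr0.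
- move=> c hc; rewrite comp_addl comp_subl w1L // v0 //.
  have /= -> := v'L (existT _ (tag (tag c)) (tagged c)); last by left; exists c.
  by rewrite subrr addr0.
- rewrite comp_addl comp_subl -vE -y1E.
  have /= -> := v'L (existT _ s0 (pr_lift h')); last by right.
  by rewrite subr0 addrC subrK.
Qed.

(** By the chain condition some probe [h0] has a subgroup on [P] that no refinement shrinks. Its
    values are then values of all its refinements and, probes being directed, of all probes. *)
Lemma pr_common_value : exists y, forall h, pr_value h y.
Proof.
have [h0 h0P] : exists h0, forall h, probe_le h0 h ->
    forall x : Hom A (G s0) P, pr_subgroup h0 x -> pr_subgroup h x.
  apply: contrapT => /forallNP nmin.
  have /choice[next nextP] : forall h, exists h', probe_le h h' /\
      ~ forall x : Hom A (G s0) P, pr_subgroup h x -> pr_subgroup h' x.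
    move=> h; have /existsNP[h' /not_implyP[? ?]] := nmin h.
    by exists h'.
  have [h1 _] := probe0.
  have [n0 n0P] := @dccP s0 (fun n => pr_subgroup (iter n next h1))
    (fun n => pr_subgroupP _)
    (fun n Y x => probe_le_subgroup (nextP _).1).
  by have [_] := nextP (iter n0 next h1); apply; apply: (n0P n0.+1).
have [y h0y] := pr_value_ex h0; exists y => h.
have [h' [h0h' hh']] := probe_ub h0 h.
apply: (probe_le_value hh').
exact: pr_value_le h0h' (h0P _ h0h') _ h0y.
Qed.

(** A common value [y] of all probes works: the finitely many arrows with constant [y] are
    coequalised to a single one, which serves as the lift of a probe made of the remaining
    equations. *)
Lemma consistent_extend : exists y : Hom A (G s0) P,
  f \oc y = x0 /\ consistent (D `|` [set existT _ s0 y]).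
Proof.
have [y yP] := pr_common_value.
have fy : f \oc y = x0.
  have [h _] := probe0; have [w [fw _ ->]] := yP h.
  by rewrite compmA fw pr_liftP.
exists y; split=> //.
pose y0 : elt := existT _ s0 y.
move=> t z L Lfin LP.
pose B : set (Hom A (G s0) (G t)) := [set b | L (existT _ y0 b)].
have zB b : B b -> z \oc b = x0 by move=> /LP[_ /= ->].
have Bfin : finite_set B.
  pose arrow_from b : arrow t := existT _ y0 b.
  apply: (@finite_preimage _ _ L arrow_from) => //.
  by move=> b b' _ _; apply: (@existT_inj2 (HB.pack elt (gen_eqMixin elt))).
have [r [z' [k [z'k kB]]]] := fp_coeq_finite Bfin zB.
pose L' := [set push k c | c in L `&` [set c | D (tag c)]].
have L'fin : finite_set L'.
  apply: finite_image; apply: sub_finite_set Lfin; exact: subIsetl.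
have L'P c : L' c -> D (tag c) /\ z' \oc tagged c = f \oc tagged (tag c).
  move=> [c' [Lc' Dc'] <-] /=; split=> //; rewrite compmA z'k.
  by have [] := LP _ Lc'.
have [[b0 Bb0]|nB] := pselect (exists b, B b).
  have zl : z' \oc (k \oc b0) = x0 by rewrite compmA z'k zB.
  have [w /= [fw wL yE]] := yP (Probe L'fin L'P zl).
  exists (w \oc k); split; first by rewrite compmA fw.
  move=> c Lc; have [[Dc|cy] _] := LP c Lc.
    by rewrite -compmA; apply: (wL (push k c)); exists c.
  case: c Lc cy => [y' b] Lc /= cy; move: b Lc; rewrite cy => b Lc /=.
  by rewrite -compmA (kB b b0).
have [w [fw wL]] := consD L'fin L'P.
exists (w \oc k); split; first by rewrite compmA fw.
move=> c Lc; have [[Dc|cy] _] := LP c Lc.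
  by rewrite -compmA; apply: (wL (push k c)); exists c.
case: c Lc cy => [y' b] Lc /= cy; move: b Lc; rewrite cy => b Lc /=.
by case: nB; exists b.
Qed.
End Extension.

Lemma pure_epi_splits : exists s : Hom A X P, f \oc s = idm X.
Proof.
have [F FF tF|D [consD Dmax]] := @Zorn_bigcup elt consistent.
  (* The empty chain has union [set0]; in a nonempty chain, a finite [L] only involves one
     member. *)
  have [F0|/existsNP] := pselect (forall D, ~ F D).
    have -> : \bigcup_(D in F) D = set0.
      by apply/seteqP; split=> // x [D /F0].
    exact: consistent0.
  move=> [D0 /contrapT FD0] t z L Lfin LP.
  pose K := {D : set elt | F D}.
  have [| | | |[D FD] DP] := @finite_set_directed _ K
      (fun D D' => sval D `<=` sval D') (fun c D => (sval D) (tag c)) L Lfin.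
  - by exists (exist _ D0 FD0).
  - move=> [D FD] [D' FD']; have [DD'|DD'] := tF D D' FD FD'.
      by exists (exist _ D' FD'); split=> //= x.
    by exists (exist _ D FD); split=> //= x.
  - by move=> c D D'; apply.
  - by move=> c /LP[[D FD Dc] _]; exists (exist _ D FD).
  apply: (FF D FD) => // c Lc; split; first exact: DP.
  by have [] := LP c Lc.
have total s (x : Hom A (G s) X) : exists y : Hom A (G s) P,
    f \oc y = x /\ D (existT _ s y).
  have [y [fy consDy]] := consistent_extend x consD.
  exists y; split=> //; apply: contrapT => nDy.
  apply: (Dmax (D `|` [set existT _ s y])) => //; split; first exact: subsetUl.
  by move=> /(_ (existT _ s y)) H; apply: nDy; apply: H; right.
pose phi s (x : Hom A (G s) X) := projT1 (cid (total s x)).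
have phiP s x : f \oc phi s x = x /\ D (existT _ s (phi s x)).
  by rewrite /phi; case: cid.
have [|h hE] := fpd_glue denseG (phi := phi).
  move=> s t x a.
  (* A common solution [w] of [w = phi s x] and [w \oc a = phi t (x \oc a)] gives naturality of
     [phi]. *)
  pose mk (y : elt) (b : Hom A (G (tag y)) (G s)) : arrow s := existT _ y b.
  pose c1 := mk (existT _ s (phi s x)) (idm (G s)).
  pose c2 := mk (existT _ t (phi t (x \oc a))) a.
  have [||w [fw wL]] := consD s x [set c1; c2].
  - by rewrite finite_setU; split; apply: finite_set1.
  - move=> c [->|->] /=; rewrite ?compm1.
      by have [-> ?] := phiP s x.
    by have [-> ?] := phiP t (x \oc a).
  have /= <- := wL c2; last by right.
  by have /= <- := wL c1; [rewrite compm1 | left].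
exists h; apply: (fpd_ext denseG) => s x.
by rewrite -compmA hE (phiP s x).1 comp1m.
Qed.

End PureEpimorphisms.

(** * Direct limits of objects of Prod(M) *)

Lemma directed_filtered (J : Type) (le : J -> J -> Prop) (dJ : directed_set le) :
  filtered (directed_category dJ).
Proof.
split; first exact: dir_nonempty dJ.
- move=> i j; have [k [ik jk]] := dir_ub dJ i j.
  by exists k; split; [exists ik | exists jk].
- by move=> i j u v; exists j, (idm j); rewrite (@Prop_irrelevance (le i j) u v : u = v).
Qed.

(** A map [z] into the colimit comes from a stage, its finitely many relations hold at a later stage
    [j], and [c j] lifts along [f]. *)
Lemma colimit_pure_epi (Ob : Type) (A : preadditive Ob) (S : Small)
    (G : S -> Ob) (J : Small) (le : J -> J -> Prop) (dJ : directed_set le)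
    (D : functor (directed_category dJ) A) (X P : Ob)
    (c : forall i, Hom A (D i) X) (f : Hom A P X) :
  fp_dense A G -> is_colimit c ->
  (forall i, exists h : Hom A (D i) P, c i = f \oc h) -> pure_epi G f.
Proof.
move=> denseG cX lift t z L Lfin zL; have fJ := directed_filtered dJ.
have [i [g zE]] := fp_factor (fpd_fp denseG t) fJ cX z.
pose K := {j : J | le i j}.
pose leK (k k' : K) := le (sval k) (sval k').
pose R (a : {s : S & Hom A (G s) (G t)}) (k : K) :=
  fmap D (proj2_sig k : Hom (directed_category dJ) i (sval k)) \oc g \oc tagged a = 0.
have [| | | |[j ij] jP] := @finite_set_directed _ K leK R L Lfin.
- by exists (exist _ i (dir_refl dJ i)).
- move=> [j ij] [k ik]; have [l [jl kl]] := dir_ub dJ j k.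
  by exists (exist _ l (dir_trans dJ ij jl)).
- move=> a [j ij] [k ik] jk E.
  suff : fmap D (ik : Hom (directed_category dJ) i k) \oc g \oc tagged a = 0 by [].
  have -> : fmap D (ik : Hom (directed_category dJ) i k) =
      fmap D (jk : Hom (directed_category dJ) j k) \oc fmap D ij.
    by rewrite -fmapM; congr fmap; apply: (@Prop_irrelevance (le i k)).
  by rewrite -(compmA _ _ g) -compmA E comp_0r.
- move=> a La; have [|j [ij E]] := fp_eq (fpd_fp denseG (tag a)) fJ cX
      (g := g \oc tagged a) (h := 0).
    by rewrite comp_0r compmA -zE zL.
  by exists (exist _ j ij); rewrite /R /= -compmA E comp_0r.
have [h hE] := lift j; exists (h \oc (fmap D ij \oc g)); split.
  by rewrite !compmA -hE cX.1.
by move=> a /jP; rewrite /R /= -!compmA => ->; rewrite comp_0r.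
Qed.

Lemma Prod_closed_under_direct_limits
  (no_measurable : forall I : Small, ~ omega_measurable I)
  (Ob : Type) (A : preadditive Ob) (lfp : locally_finitely_presented A)
  (M : Ob) :
  precovering A (Prod A M) -> closed_under_direct_limits A (Prod A M).
Proof.
move=> precM J le dJ D X c DM cX.
have [_ cocA _ _] := lfp; have [S [G denseG]] := lfp_dense lfp.
have [I [P [p [f [productP fP]]]]] := precover_by_power X precM.
have pure : pure_epi G f.
  by apply: (colimit_pure_epi denseG cX) => i; apply: fP.
have [|s fs] := pure_epi_splits denseG pure.
  move=> s U sfU U_decr.
  have [n0 n0P] :=
    subgroup_functor_dcc cocA no_measurable precM (fpd_fp denseG s) sfU U_decr.
  (* The chain condition passes from [M] to its power [P] coordinatewise. *)
  exists n0 => n x xU; apply: (sf_product (sfU n) productP) => i.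
  by apply: n0P; apply: sf_comp (sfU n0) _ _ _ _ xU.
by exists I, P, p; split=> //; apply: (retract_summand cocA fs).
Qed.

Theorem corollary3p11
  (no_measurable : forall I : Small, ~ omega_measurable I)
  (Ob : Type) (A : preadditive Ob) (lfp : locally_finitely_presented A)
  (M : Ob) :
  (precovering A (Prod A M) -> closed_under_direct_limits A (Prod A M)) /\
  (covering A (Prod A M) -> closed_under_direct_limits A (Prod A M)).
Proof.
have precov := Prod_closed_under_direct_limits no_measurable lfp (M := M).
by split=> // cov; apply: precov => Y; have [X [f [fY _]]] := cov Y; exists X, f.
Qed.
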